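(* Let $V$ be an $m\times n$ $(0,1)$-matrix and $B$ a $p\times q$ $(0,1)$-matrix, and let $L=\begin{bmatrix}0 & V\\ V^T & 0\end{bmatrix}$, $H=\begin{bmatrix}0 & B\\ B^T & 0\end{bmatrix}$, $H^{\#}=\begin{bmatrix}0 & B^T\\ B & 0\end{bmatrix}$. Suppose the bipartite graphs $G_L$ and $G_H$ have no isolated vertices. Then the bipartite graphs $G_{L\underline{\otimes}H}$ and $G_{L\underline{\otimes}H^{\#}}$ are cospectral for the normalized Laplacian matrices if and only if at least one of $G_L$ or $G_H$ is balanced, i.e. if and only if $m=n$ or $p=q$.
   Context: For a symmetric $(0,1)$-matrix $A$ with zero diagonal, $G_A$ denotes the simple graph whose adjacency matrix is $A$. Thus $G_L$ is the bipartite graph with partite sets of sizes $m$ (indexed by rows of $V$) and $n$ (indexed by columns of $V$) and biadjacency matrix $V$; similarly $G_H$ has partite sets of sizes $p$ and $q$ and biadjacency matrix $B$. $G_L$ is called balanced if $m=n$, and $G_H$ if $p=q$. The partitioned tensor product of two $2\times 2$ block matrices $M=\begin{bmatrix}U & V'\\ W & X\end{bmatrix}$ and $N=\begin{bmatrix}A & B'\\ C & D\end{bmatrix}$ is $M\underline{\otimes}N=\begin{bmatrix}U\otimes A & V'\otimes B'\\ W\otimes C & X\otimes D\end{bmatrix}$ ($\otimes$ the Kronecker product). Hence $L\underline{\otimes}H=\begin{bmatrix}0 & V\otimes B\\ V^T\otimes B^T & 0\end{bmatrix}$ (of order $mp+nq$) and $L\underline{\otimes}H^{\#}=\begin{bmatrix}0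 & V\otimes B^T\\ V^T\otimes B & 0\end{bmatrix}$ (of order $mq+np$). The normalized Laplacian of a graph $G$ without isolated vertices is $\mathcal{L}(G)=I-D(G)^{-1/2}A(G)D(G)^{-1/2}$, with $A(G)$ the adjacency matrix and $D(G)$ the diagonal degree matrix; two graphs are cospectral for the normalized Laplacian matrices if these matrices have the same spectrum (with multiplicities). *)

(* Defs.v *)
From HB Require Import structures.
From mathcomp Require Import all_boot all_order all_algebra.
From mathcomp Require Export mxtens.

Set Implicit Arguments.
Unset Strict Implicit.
Unset Printing Implicit Defensive.

Import Order.TTheory GRing.Theory Num.Theory.
Local Open Scope ring_scope.

Definition zero_one_mx (R : pzRingType) m n (A : 'M[R]_(m, n)) : Prop :=
  forall i j, A i j = 0 \/ A i j = 1.

(* A graph on the vertex set 'I_k is its adjacency relation. [graph_mx A] is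
   the graph G_A; it is meaningful for symmetric (0,1)-matrices with zero
   diagonal, for which it is simple and has adjacency matrix A: see the lemmas
   [graph_mx_sym], [graph_mx_irr] and [adjmx_graph_mx]. *)
Definition graph_mx (R : nzRingType) k (A : 'M[R]_k) : rel 'I_k :=
  fun i j => A i j == 1.

Definition degree k (e : rel 'I_k) (i : 'I_k) : nat := #|[pred j | e i j]|.

Definition no_isolated k (e : rel 'I_k) : Prop := forall i, (0 < degree e i)%N.

Definition adjmx (R : nzRingType) k (e : rel 'I_k) : 'M[R]_k :=
  \matrix_(i, j) (e i j)%:R.

(* D(G)^(-1/2), for G without isolated vertices. *)
Definition degmx_invsqrt (R : rcfType) k (e : rel 'I_k) : 'M[R]_k :=
  diag_mx (\row_i (Num.sqrt (degree e i)%:R)^-1).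

Definition normalized_laplacian (R : rcfType) k (e : rel 'I_k) : 'M[R]_k :=
  1%:M - degmx_invsqrt R e *m adjmx R e *m degmx_invsqrt R e.

(* Equality of spectra as multisets: every a has the same algebraic
   multiplicity on both sides. The orders k and l are not assumed equal. The
   eigenvalues of a symmetric matrix over R all lie in R, so for such matrices
   no eigenvalue is missed by letting a range over R only. *)
Definition cospectral (R : rcfType) k l (M : 'M[R]_k) (N : 'M[R]_l) : Prop :=
  forall a : R, mup a (char_poly M) = mup a (char_poly N).

Definition cospectral_normalized_laplacian (R : rcfType) k l
    (e : rel 'I_k) (f : rel 'I_l) : Prop :=
  cospectral (normalized_laplacian R e) (normalized_laplacian R f).

(* The partition of each factor is carried by its type. *)
Definition ptensmx (R : pzRingType) m1 m2 n1 n2 p1 p2 q1 q2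
    (M : 'M[R]_(m1 + m2, n1 + n2)) (N : 'M[R]_(p1 + p2, q1 + q2)) :
    'M[R]_(m1 * p1 + m2 * p2, n1 * q1 + n2 * q2) :=
  block_mx (ulsubmx M *t ulsubmx N) (ursubmx M *t ursubmx N)
           (dlsubmx M *t dlsubmx N) (drsubmx M *t drsubmx N).

Lemma graph_mx_sym (R : nzRingType) k (A : 'M[R]_k) :
  A^T = A -> symmetric (graph_mx A).
Proof. by move=> symA i j; rewrite /graph_mx -{1}symA mxE. Qed.

Lemma graph_mx_irr (R : nzRingType) k (A : 'M[R]_k) :
  (forall i, A i i = 0) -> irreflexive (graph_mx A).
Proof. by move=> dA i; rewrite /graph_mx dA eq_sym oner_eq0. Qed.

Lemma adjmx_graph_mx (R : nzRingType) k (A : 'M[R]_k) :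
  zero_one_mx A -> adjmx R (graph_mx A) = A.
Proof.
move=> A01; apply/matrixP => i j; rewrite mxE /graph_mx.
by case: (A01 i j) => ->; rewrite ?eqxx // eq_sym oner_eq0.
Qed.

Lemma ptensmx_block (R : pzRingType) m1 m2 n1 n2 p1 p2 q1 q2
    (U : 'M[R]_(m1, n1)) (V : 'M_(m1, n2)) (W : 'M_(m2, n1)) (X : 'M_(m2, n2))
    (A : 'M[R]_(p1, q1)) (B : 'M_(p1, q2)) (C : 'M_(p2, q1)) (D : 'M_(p2, q2)) :
  ptensmx (block_mx U V W X) (block_mx A B C D)
  = block_mx (U *t A) (V *t B) (W *t C) (X *t D).
Proof.
by rewrite /ptensmx !block_mxKul !block_mxKur !block_mxKdl !block_mxKdr.
Qed.

(* Main.v *)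
(** If P and Q are the degree-normalized biadjacency matrices of G_L and G_H,
    the normalized adjacency matrices of the two product graphs are ST and TS,
    where S = diag(I (x) Q, I (x) Q^T) and T is antidiagonal with blocks
    P (x) I and P^T (x) I.  As ST and TS have the same characteristic
    polynomial up to a power of X, the two normalized Laplacians have the same
    characteristic polynomial up to a power of X - 1, the exponent being the
    difference mp + nq - (mq + np) = (m - n)(p - q) of the orders.  Hence the
    spectra agree if and only if this difference vanishes. *)

Require Import Defs.
From HB Require Import structures.
From mathcomp Require Import all_boot all_order all_algebra.
From mathcomp Require Import zify ring.

Set Implicit Arguments.
Unset Strict Implicit.
Unset Printing Implicit Defensive.

Import Order.TTheory GRing.Theory Num.Theory.
Local Open Scope ring_scope.

(** Two block triangular matrices, of determinants 1 and [y ^+ b], each clear one off-diagonal block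
    of the same [K], giving two expressions for its determinant. Nothing is divided by [y], so [y]
    may be a polynomial. *)
Lemma det_scalar_mx_sub_mulmxC (R : comPzRingType) a b (y : R)
    (M : 'M[R]_(a, b)) (N : 'M[R]_(b, a)) :
  y ^+ b * \det (y%:M - M *m N) = y ^+ a * \det (y%:M - N *m M).
Proof.
pose K := block_mx y%:M M N 1%:M.
have detl : \det K = \det (y%:M - M *m N).
  have : K *m block_mx 1%:M 0 (- N) 1%:M = block_mx (y%:M - M *m N) M 0 1%:M.
    by rewrite mulmx_block !mulmx1 !mulmx0 !add0r !mul1mx mulmxN addrN.
  move/(congr1 determinant).
  by rewrite det_mulmx det_lblock det_ublock !det1 !mulr1.
have : K *m block_mx 1%:M (- M) 0 y%:M = block_mx y%:M 0 N (y%:M - N *m M).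
  rewrite mulmx_block !mulmx1 !mulmx0 !addr0 !mul1mx !mulmxN.
  by rewrite mul_scalar_mx mul_mx_scalar addNr (addrC (- _)).
move/(congr1 determinant).
by rewrite det_mulmx det_lblock det_ublock !det1 mul1r !det_scalar mulrC detl.
Qed.

Lemma char_poly_sub_mulmxC (R : comNzRingType) a b
    (M : 'M[R]_(a, b)) (N : 'M[R]_(b, a)) :
  ('X - 1) ^+ b * char_poly (1%:M - M *m N)
  = ('X - 1) ^+ a * char_poly (1%:M - N *m M).
Proof.
(* X I - (I - A B) = (X - 1) I - (-A) B, so the determinant identity applies with y = X - 1; the
   sign is moved to the other factor afterwards. *)
have E k l (A : 'M[R]_(k, l)) B : char_poly_mx (1%:M - A *m B)
    = ('X - 1)%:M - map_mx polyC (- A) *m map_mx polyC B.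
  rewrite /char_poly_mx -map_mxM mulNmx map_mxN map_mxB map_scalar_mx opprB.
  by rewrite (raddfB (@scalar_mx _ k)) opprK /= addrCA addrC.
rewrite /char_poly !E det_scalar_mx_sub_mulmxC.
by rewrite map_mxN mulmxN -mulNmx -map_mxN.
Qed.

(** The upper right block of D^(-1/2) A D^(-1/2) for the bipartite graph of a (0,1)-matrix [V],
    whose row and column sums are the degrees. *)
Definition normalized_biadj (R : rcfType) m n (V : 'M[R]_(m, n)) : 'M[R]_(m, n) :=
  \matrix_(i, j) ((Num.sqrt (\sum_k V i k))^-1 * V i j
                  * (Num.sqrt (\sum_k V k j))^-1).

Lemma normalized_biadj_tr (R : rcfType) m n (V : 'M[R]_(m, n)) :
  normalized_biadj V^T = (normalized_biadj V)^T.
Proof.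
apply/matrixP => i j; rewrite !mxE [RHS]mulrC -mulrA [V j i * _]mulrC.
have -> : \sum_k V^T i k = \sum_k V k i by apply: eq_bigr => k _; rewrite mxE.
by have -> : \sum_k V^T k j = \sum_k V j k by apply: eq_bigr => k _; rewrite mxE.
Qed.

Lemma zero_one_mx_sum_ge0 (R : rcfType) m n (V : 'M[R]_(m, n)) i :
  zero_one_mx V -> 0 <= \sum_k V i k.
Proof. by move=> V01; apply: sumr_ge0 => k _; case: (V01 i k) => ->. Qed.

Lemma zero_one_mx_tr (R : pzRingType) m n (V : 'M[R]_(m, n)) :
  zero_one_mx V -> zero_one_mx V^T.
Proof. by move=> V01 i j; rewrite mxE. Qed.

Lemma zero_one_mx_tens (R : pzRingType) m n p q
    (V : 'M[R]_(m, n)) (B : 'M[R]_(p, q)) :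
  zero_one_mx V -> zero_one_mx B -> zero_one_mx (V *t B).
Proof.
move=> V01 B01 i j; rewrite mxE.
case: (V01 (mxtens_unindex i).1 (mxtens_unindex j).1) => ->; last by rewrite mul1r.
by rewrite mul0r; left.
Qed.

(** Row and column sums are multiplicative under the Kronecker product, and the square root splits
    because the sums for [V] are nonnegative. *)
Lemma normalized_biadj_tens (R : rcfType) m n p q
    (V : 'M[R]_(m, n)) (B : 'M[R]_(p, q)) :
  zero_one_mx V -> zero_one_mx B ->
  normalized_biadj (V *t B) = normalized_biadj V *t normalized_biadj B.
Proof.
move=> V01 B01; apply/matrixP => i j.
case: (mxtens_indexP i) => i0 i1; case: (mxtens_indexP j) => j0 j1.
have row_sum : \sum_k (V *t B) (mxtens_index (i0, i1)) k
    = (\sum_k V i0 k) * (\sum_k B i1 k).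
  rewrite mulr_sum; apply: eq_bigr => k _.
  by case: (mxtens_indexP k) => k0 k1; rewrite tensmxE mxtens_indexK.
have col_sum : \sum_k (V *t B) k (mxtens_index (j0, j1))
    = (\sum_k V k j0) * (\sum_k B k j1).
  rewrite mulr_sum; apply: eq_bigr => k _.
  by case: (mxtens_indexP k) => k0 k1; rewrite tensmxE mxtens_indexK.
have col_ge0 : 0 <= \sum_k V k j0.
  have := zero_one_mx_sum_ge0 j0 (zero_one_mx_tr V01).
  by under eq_bigr do rewrite mxE.
rewrite tensmxE mxE row_sum col_sum tensmxE !mxE.
by rewrite !sqrtrM ?zero_one_mx_sum_ge0 // !invfM; ring.
Qed.

Lemma degree_graph_mx (R : nzRingType) k (A : 'M[R]_k) i :
  zero_one_mx A -> (degree (graph_mx A) i)%:R = \sum_j A i j.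
Proof.
move=> A01; rewrite /degree -sum1_card natr_sum.
rewrite big_mkcond; apply: eq_bigr => j _; rewrite unfold_in /= /graph_mx.
by case: (A01 i j) => ->; rewrite ?eqxx // eq_sym oner_eq0.
Qed.

Lemma normalized_laplacian_bipartite (R : rcfType) m n (V : 'M[R]_(m, n)) :
  zero_one_mx V ->
  normalized_laplacian R (graph_mx (block_mx 0 V V^T 0))
  = 1%:M - block_mx 0 (normalized_biadj V) (normalized_biadj V)^T 0.
Proof.
move=> V01; set A := block_mx _ _ _ _.
have A01 : zero_one_mx A.
  move=> i j; rewrite /A !mxE; case: splitP => i' _; rewrite !mxE.
    by case: splitP => j' _; rewrite ?mxE //; left.
  by case: splitP => j' _; rewrite ?mxE //; left.
rewrite /normalized_laplacian adjmx_graph_mx //; congr (_ - _).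
have -> : degmx_invsqrt R (graph_mx A)
    = diag_mx (row_mx (\row_i (Num.sqrt (\sum_k V i k))^-1)
                      (\row_j (Num.sqrt (\sum_k V k j))^-1)).
  rewrite /degmx_invsqrt; congr diag_mx; apply/rowP => i.
  rewrite mxE degree_graph_mx // big_split_ord /=.
  rewrite -[i]splitK; case: (split i) => i' /=.
    rewrite row_mxEl mxE; congr (GRing.inv (Num.sqrt _)).
    rewrite big1 ?add0r => [|k _]; last by rewrite block_mxEul mxE.
    by apply: eq_bigr => k _; rewrite block_mxEur.
  rewrite row_mxEr mxE; congr (GRing.inv (Num.sqrt _)).
  rewrite addrC big1 ?add0r => [|k _]; last by rewrite block_mxEdr mxE.
  by apply: eq_bigr => k _; rewrite block_mxEdl mxE.
rewrite diag_mx_row mulmx_block !mulmx_block.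
rewrite !(mulmx0, mul0mx, addr0, add0r); congr block_mx; apply/matrixP => i j.
  by rewrite mul_mx_diag mul_diag_mx !mxE.
by rewrite mul_mx_diag mul_diag_mx !mxE [LHS]mulrC mulrA mulrAC.
Qed.

Lemma char_poly_laplacian_ptensmx (R : rcfType) m n p q
    (V : 'M[R]_(m, n)) (B : 'M[R]_(p, q)) :
  zero_one_mx V -> zero_one_mx B ->
  let L := block_mx 0 V V^T 0 in
  ('X - 1) ^+ (m * q + n * p) * char_poly
    (normalized_laplacian R (graph_mx (ptensmx L (block_mx 0 B B^T 0))))
  = ('X - 1) ^+ (m * p + n * q) * char_poly
    (normalized_laplacian R (graph_mx (ptensmx L (block_mx 0 B^T B 0)))).
Proof.
move=> V01 B01 L; rewrite !ptensmx_block !tens0mx.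
have B01t := zero_one_mx_tr B01.
rewrite -trmx_tens.
(* Both products now have the bipartite form, with biadjacency matrices [V *t B] and [V *t B^T]. *)
have -> : V^T *t B = (V *t B^T)^T by rewrite trmx_tens trmxK.
rewrite !normalized_laplacian_bipartite; try exact: zero_one_mx_tens.
rewrite !normalized_biadj_tens // normalized_biadj_tr.
set P := normalized_biadj V; set Q := normalized_biadj B.
(* [S] acts on the tensor factor of [B] only and [T] on that of [V] only, so each passes between the
   index sets of the two product graphs. *)
pose S : 'M_(m * p + n * q, m * q + n * p) :=
  block_mx (1%:M *t Q) 0 0 (1%:M *t Q^T).
pose T : 'M_(m * q + n * p, m * p + n * q) :=
  block_mx 0 (P *t 1%:M) (P^T *t 1%:M) 0.
have -> : block_mx 0 (P *t Q) (P *t Q)^T 0 = S *m T.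
  rewrite mulmx_block !(mulmx0, mul0mx, addr0, add0r) !tensmx_mul.
  by rewrite !mul1mx !mulmx1 trmx_tens.
have -> : block_mx 0 (P *t Q^T) (P *t Q^T)^T 0 = T *m S.
  rewrite mulmx_block !(mulmx0, mul0mx, addr0, add0r) !tensmx_mul.
  by rewrite !mul1mx !mulmx1 trmx_tens trmxK.
exact: char_poly_sub_mulmxC.
Qed.

Theorem theorem3p3 (R : rcfType) (m n p q : nat)
    (V : 'M[R]_(m, n)) (B : 'M[R]_(p, q))
    (L : 'M[R]_(m + n)) (H : 'M[R]_(p + q)) (Hs : 'M[R]_(q + p))
    (V01 : zero_one_mx V) (B01 : zero_one_mx B)
    (defL : L = block_mx 0 V V^T 0)
    (defH : H = block_mx 0 B B^T 0)
    (defHs : Hs = block_mx 0 B^T B 0)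
    (isoL : no_isolated (graph_mx L)) (isoH : no_isolated (graph_mx H)) :
  cospectral_normalized_laplacian R
    (graph_mx (ptensmx L H)) (graph_mx (ptensmx L Hs))
  <-> (m = n \/ p = q).
Proof.
have := char_poly_laplacian_ptensmx V01 B01.
rewrite /= -defL -defH -defHs /cospectral_normalized_laplacian /cospectral.
set M := normalized_laplacian _ _; set N := normalized_laplacian _ _ => eqMN.
have X1_neq0 k : ('X - 1 : {poly R}) ^+ k != 0.
  by rewrite expf_neq0 // -polyC1 polyXsubC_eq0.
have chi_neq0 k (A : 'M[R]_k) : char_poly A != 0.
  exact: monic_neq0 (char_poly_monic A).
split=> [cosp | balanced a].
  (* Compare multiplicities of the root 1 of X - 1: those of the two characteristic polynomials
     cancel, which leaves the exponents. *)
  have /(congr1 (mup 1)) := eqMN.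
  rewrite !mupM // (cosp 1) -polyC1 !mup_XsubCX eqxx => /addIn orders.
  (* [orders] amounts to (m - n)(p - q) = 0 over the integers. *)
  by nia.
have orders : (m * q + n * p = m * p + n * q)%N by case: balanced => ->; lia.
have -> // : char_poly M = char_poly N.
(* With equal exponents, the common nonzero power of X - 1 cancels. *)
by apply: (mulfI (X1_neq0 (m * q + n * p)%N)); rewrite eqMN -orders.
Qed.
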